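(* Let $n=3$. The function $W_{vv}$ is a relative invariant of the $\mathcal{G}$-action on $\mathcal{E}^2$. On the submanifold in $\mathcal{E}^3$ given by $W_{vv}=0$ and its differential consequences, the function $H_{vvv}$ is a relative invariant of the $\mathcal{G}$-action.
   Context: Three-dimensional Kundt metrics in adapted coordinates $(u,x,v)$ are $g=du\,(dv+H\,du+W\,dx)+h\,dx^2$ with $H,W$ functions of $(u,x,v)$ and $h=h(u,x)>0$. Let $\pi$ be the trivial bundle over $\mathbb{R}^3(u,x,v)$ with fiber coordinates $H,W,h$ ($h>0$). For $k\ge1$, $\mathcal{E}^k\subset J^k\pi$ is given by $h_v=0$ and its total derivatives of order $\le k$. The differential consequences of $W_{vv}=0$ in $\mathcal{E}^3$ are its first-order total derivatives. $\mathcal{G}$ is the Lie pseudogroup of local diffeomorphisms $(u,x,v)\mapsto(C(u),A(u,x),v/C'(u)+B(u,x))$ with $A_x\neq0$, $C'\ne0$; it acts on Kundt metrics of the form $g=du\,(dv+H\,du+W\,dx)+h\,dx^2$, hence on $J^0\pi$ (so that $g$, viewed as a horizontal symmetric 2-form on $\pi$, is invariant), and the action prolongs to jets preserving $\mathcal{E}^k$. Subscripts denote jet variables. A function $f$ on a $\mathcal{G}$-invariant submanifold of $k$-jets is a relative (differential) invariant if for every $\varphi\in\mathcal{G}$ one has $\varphi^*f=s_\varphi\cdot f$ for some nonzero function $s_\varphi$ on that submanifold, where $\varphi^*$ is the pullback by the prolonged action of $\varphi$. *)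

(* Defs.v *)
From HB Require Import structures.
From mathcomp Require Import all_boot all_order all_algebra.
From mathcomp Require Import all_classical all_reals all_analysis.
Set Implicit Arguments.
Unset Strict Implicit.
Unset Printing Implicit Defensive.
Import Order.TTheory GRing.Theory Num.Theory.
Import numFieldNormedType.Exports.
Local Open Scope classical_set_scope.
Local Open Scope ring_scope.

(* For finite-dimensional [V] and open [O] this is C^oo-smoothness on [O]:
   all iterated directional derivatives are Frechet differentiable there.
   Values of [f] outside [O] play no role. *)
Definition smooth_on (R : realType) (V W : normedModType R)
    (O : set V) (f : V -> W) : Prop :=
  forall (l : seq V) (p : V), O p ->
    differentiable (foldr (fun v g => fun q => 'D_v g q) f l) p.

(* Base coordinates (u, x, v) and fibre coordinates (H, W, h). *)
Definition iu : 'I_3 := @Ordinal 3 0 isT.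
Definition ix : 'I_3 := @Ordinal 3 1 isT.
Definition iv : 'I_3 := @Ordinal 3 2 isT.
Definition iH : 'I_3 := @Ordinal 3 0 isT.
Definition iW : 'I_3 := @Ordinal 3 1 isT.
Definition ih : 'I_3 := @Ordinal 3 2 isT.

(* The quadratic form  du (dv + H du + W dx) + h dx^2  on tangent vectors. *)
Definition kundt (R : realType) (w X : 'rV[R]_3) : R :=
  X 0 iu * (X 0 iv + w 0 iH * X 0 iu + w 0 iW * X 0 ix) + w 0 ih * X 0 ix ^+ 2.

Definition local_diffeo (R : realType) (U : set 'rV[R]_3)
    (phi : 'rV[R]_3 -> 'rV[R]_3) : Prop :=
  [/\ open U, open (phi @` U), smooth_on U phi &
      exists2 psi : 'rV[R]_3 -> 'rV[R]_3,
        smooth_on (phi @` U) psi & forall q, U q -> psi (phi q) = q].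

(* [phi], restricted to its open domain [U], belongs to the pseudogroup of maps
   (u, x, v) |-> (C(u), A(u, x), v / C'(u) + B(u, x)). *)
Definition in_pseudogroup (R : realType) (U : set 'rV[R]_3)
    (phi : 'rV[R]_3 -> 'rV[R]_3) : Prop :=
  local_diffeo U phi /\
  exists (C : R -> R) (A B : R * R -> R),
    [/\ smooth_on [set q 0 iu | q in U] C,
        smooth_on [set (q 0 iu, q 0 ix) | q in U] A,
        smooth_on [set (q 0 iu, q 0 ix) | q in U] B &
        forall q, U q ->
          let u := q 0 iu in let x := q 0 ix in let v := q 0 iv in
          [/\ derive1 C u != 0, 'D_(0, 1) A (u, x) != 0,
              phi q 0 iu = C u, phi q 0 ix = A (u, x) &
              phi q 0 iv = v / derive1 C u + B (u, x)]].

(* The action on J^0: (q, w) is sent to (phi q, w') precisely when the metric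
   with coefficients w' at phi q pulls back to the one with coefficients w
   at q. *)
Definition acts0 (R : realType) (phi : 'rV[R]_3 -> 'rV[R]_3)
    (q w w' : 'rV[R]_3) : Prop :=
  forall X : 'rV[R]_3, kundt w' ('d phi q X) = kundt w X.

(* Multi-indices (i, j, l), standing for D_u^i D_x^j D_v^l, of order <= k. *)
Definition midx (k : nat) : finType :=
  {I : 'I_k.+1 * 'I_k.+1 * 'I_k.+1 | (I.1.1 + I.1.2 + I.2 <= k)%N}.

(* Ambient space of k-jets: a base point together with the values of the
   derivatives of order <= k of the three fibre coordinates.  The fibre
   condition h > 0 of the bundle is imposed in [Ek]. *)
Definition jet (R : realType) (k : nat) : normedModType R :=
  ('rV[R]_3 * 'M[R]_(3, #|midx k|))%type.

(* The jet coordinate of the [a]-th fibre coordinate with multi-index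
   (i, j, l); it is the constant 0 when i + j + l > k. *)
Definition jcoord (R : realType) (k : nat) (a : 'I_3) (i j l : nat)
    (J : jet R k) : R :=
  \sum_(I : midx k |
        [&& (val I).1.1 == i :> nat, (val I).1.2 == j :> nat
          & (val I).2 == l :> nat]) J.2 a (enum_rank I).

Definition partial (R : realType) (i j l : nat) (f : 'rV[R]_3 -> R)
    : 'rV[R]_3 -> R :=
  let D (a : 'I_3) (g : 'rV[R]_3 -> R) := fun q => 'D_(delta_mx 0 a) g q in
  iter i (D iu) (iter j (D ix) (iter l (D iv) f)).

Definition jet_of (R : realType) (k : nat) (s : 'rV[R]_3 -> 'rV[R]_3)
    (p : 'rV[R]_3) : jet R k :=
  (p, \matrix_(a < 3, c < #|midx k|)
        let I := val (enum_val c : midx k) in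
        partial I.1.1 I.1.2 I.2 (fun q => s q 0 a) p).

Definition local_section (R : realType) (s : 'rV[R]_3 -> 'rV[R]_3)
    (p : 'rV[R]_3) : Prop :=
  exists O : set 'rV[R]_3,
    [/\ open O, O p, smooth_on O s & forall q, O q -> 0 < s q 0 ih].

(* Graph of the prolonged action of [phi] on k-jets: the k-jet at p of a section
   s is sent to the k-jet at phi p of the section s' whose graph is the image
   of the graph of s. *)
Definition prolongs (R : realType) (k : nat) (U : set 'rV[R]_3)
    (phi : 'rV[R]_3 -> 'rV[R]_3) (J J' : jet R k) : Prop :=
  U J.1 /\
  exists s s' : 'rV[R]_3 -> 'rV[R]_3,
    [/\ local_section s J.1, local_section s' (phi J.1),
        \forall q \near J.1, acts0 phi q (s q) (s' (phi q)),
        J = jet_of k s J.1 & J' = jet_of k s' (phi J.1)].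

(* The total derivative D_u^i D_x^j D_v^l of the coordinate function h_v is the
   coordinate function of h with multi-index (i, j, l+1). *)
Definition Ek (R : realType) (k : nat) : set (jet R k) :=
  [set J | 0 < jcoord ih 0 0 0 J /\
    forall i j l, (i + j + l.+1 <= k)%N -> jcoord ih i j l.+1 J = 0].

Definition invariant (R : realType) (k : nat) (S : set (jet R k)) : Prop :=
  forall U phi J J', in_pseudogroup U phi -> prolongs U phi J J' -> S J -> S J'.

(* The weight [s], which may depend on [phi], is a smooth nowhere vanishing function on the part of [S] over
   the domain of [phi]; smoothness on a submanifold means being the restriction
   of a function smooth on an open neighbourhood.  The last clause is
   phi^* f = s f. *)
Definition relative_invariant (R : realType) (k : nat) (S : set (jet R k))
    (f : jet R k -> R) : Prop :=
  invariant S /\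
  forall U phi, in_pseudogroup U phi ->
    exists (s : jet R k -> R) (O : set (jet R k)),
      [/\ open O, S `&` [set J | U J.1] `<=` O, smooth_on O s,
          forall J, S J -> U J.1 -> s J != 0 &
          forall J J', S J -> prolongs U phi J J' -> f J' = s J * f J].

(* The submanifold of the third-order equation cut out by W_vv = 0 and its
   first-order total derivatives W_uvv = W_xvv = W_vvv = 0. *)
Definition E3_Wvv0 (R : realType) : set (jet R 3) :=
  @Ek R 3 `&` [set J | [/\ jcoord iW 0 0 2 J = 0, jcoord iW 1 0 2 J = 0,
                          jcoord iW 0 1 2 J = 0 & jcoord iW 0 0 3 J = 0]].

(* Main.v *)
(* Write P = D_u phi_u, Q = D_x phi_x, T = D_u phi_x,
   S = D_x phi_v, Z = D_u phi_v.  Comparing coefficients in phi^* g' = g gives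
     h = Q^2 h',  W = P S + P Q W' + 2 T Q h',
     H = P Z + P^2 H' + P T W' + T^2 h',
   with the primed functions taken at phi.  Since D_v phi_v = 1/P and
   D_v phi_u = D_v phi_x = 0, symmetry of mixed derivatives shows that P, Q, T, S
   and D_v Z do not depend on v, and D_v (f o phi) = (1/P) (D_v f) o phi.  Hence
   D_v^2 W and D_v^3 H involve only D_v^2 W', D_v^2 h', resp. D_v^3 H', D_v^3 W',
   D_v^3 h', and modulo the equations W'_vv = (P/Q) W_vv, H'_vvv = P H_vvv.
   The equations themselves say that h_v (and W_vv) vanish at the point to some
   order; this survives products with smooth functions and composition with a
   local diffeomorphism, whence the invariance. *)
Require Import Defs.
From mathcomp Require Import all_boot all_order all_algebra.
From mathcomp Require Import all_classical all_reals all_analysis.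
From mathcomp Require Import ring lra zify.
Set Implicit Arguments.
Unset Strict Implicit.
Unset Printing Implicit Defensive.
Import Order.TTheory GRing.Theory Num.Theory.
Import numFieldNormedType.Exports.
Local Open Scope classical_set_scope.
Local Open Scope ring_scope.

(** * Smooth functions on an open set and their closure properties *)

Lemma smooth_onS (R : realType) (V W : normedModType R) (O N : set V)
    (f : V -> W) : N `<=` O -> smooth_on O f -> smooth_on N f.
Proof. by move=> NO fO l p /NO; exact: fO. Qed.

Lemma smooth_on_differentiable (R : realType) (V W : normedModType R)
    (O : set V) (f : V -> W) (p : V) :
  smooth_on O f -> O p -> differentiable f p.
Proof. by move=> fO /(fO [::]). Qed.

Lemma smooth_on_derivable (R : realType) (V W : normedModType R)
    (O : set V) (f : V -> W) (p v : V) :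
  smooth_on O f -> O p -> derivable f p v.
Proof. by move=> fO Op; apply/diff_derivable/(smooth_on_differentiable fO). Qed.

Lemma smooth_on_derive (R : realType) (V W : normedModType R)
    (O : set V) (f : V -> W) (v : V) :
  smooth_on O f -> smooth_on O ('D_v f).
Proof. by move=> fO l p /(fO (rcons l v)); rewrite foldr_rcons. Qed.

Lemma eq_on_derive (R : realType) (V W : normedModType R) (O : set V)
    (f g : V -> W) (v p : V) :
  open O -> (forall q, O q -> f q = g q) -> O p -> 'D_v f p = 'D_v g p.
Proof.
move=> oO fg Op; apply: near_eq_derive.
by apply: filterS (open_nbhs_nbhs (conj oO Op)).
Qed.

(** The differential is chosen among the continuous linear maps that realise the first-order
    expansion. The expansion only sees values near the point, so ['d f p] qualifies for [g] as
    well. *)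
Lemma eq_on_differentiable (R : realType) (V W : normedModType R) (O : set V)
    (f g : V -> W) (p : V) :
  open O -> (forall q, O q -> f q = g q) -> O p ->
  differentiable f p -> differentiable g p.
Proof.
move=> oO fg Op df.
have nO : nbhs p O by exact: open_nbhs_nbhs.
have limp : lim (nbhs p) = p by exact: lim_id.
have [[dc /eqaddoP fo]] := df.
apply/diffP; apply: (@getPex _ (fun d : {linear V -> W} => continuous d /\
  forall y, g y = g (lim (nbhs p)) + d (y - lim (nbhs p))
                  +o_(y \near p) (y - lim (nbhs p)))).
exists ('d f p); split=> //.
suff : g = cst (g (lim (nbhs p))) + 'd f p \o center (lim (nbhs p))
    +o_ p (center (lim (nbhs p))) by rewrite funeqE.
apply/eqaddoP => e /fo; apply: filterS2 nO => q Oq.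
by rewrite /= !fctE limp !fg.
Qed.

(** Smoothness is the largest class of functions differentiable on [O] that is stable under
    directional derivatives, so any invariant [P] proves it. Equality on [O] is enough at each stage
    because [O] is open and derivatives are local. *)
Lemma smooth_on_coind (R : realType) (V W : normedModType R) (O : set V)
    (P : (V -> W) -> Prop) : open O ->
  (forall f, P f -> (forall p, O p -> differentiable f p) /\
     forall v, exists2 g, P g & forall p, O p -> 'D_v f p = g p) ->
  forall f, P f -> smooth_on O f.
Proof.
move=> oO HP f Pf l p Op.
suff [g [Pg fg]] : exists g, P g /\ forall q, O q ->
    foldr (fun v g => fun q => 'D_v g q) f l q = g q.
  apply: (@eq_on_differentiable _ _ _ O g) => //; last exact: (HP _ Pg).1.
  by move=> q Oq; rewrite fg.
elim: l => [|v l [g [Pg fg]]] /=; first by exists f.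
have [_ /(_ v)[g' Pg' gg']] := HP _ Pg.
exists g'; split=> // q Oq.
by rewrite -gg'//; exact: eq_on_derive oO _ Oq.
Qed.

Lemma derive_coord (R : realType) (V : normedModType R) (m n : nat)
    (f : V -> 'M[R]_(m.+1, n.+1)) (p v : V) (i : 'I_m.+1) (j : 'I_n.+1) :
  differentiable f p -> 'D_v (fun q => f q i j) p = 'D_v f p i j.
Proof. by move=> df; rewrite derive_mx ?mxE//; exact: diff_derivable. Qed.

Lemma smooth_on_coord (R : realType) (V : normedModType R) (m n : nat) (O : set V)
    (f : V -> 'M[R]_(m.+1, n.+1)) (i : 'I_m.+1) (j : 'I_n.+1) :
  open O -> smooth_on O f -> smooth_on O (fun q => f q i j).
Proof.
move=> oO fO.
apply: (smooth_on_coind (P := fun g => exists2 f : V -> 'M[R]_(m.+1, n.+1),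
  smooth_on O f & g = (fun q => f q i j))) => //; last by exists f.
move=> {f fO}_ [f fO ->]; split=> [p Op|v].
  apply: (@differentiable_comp _ _ _ _ f (fun M : 'M[R]_(m.+1, n.+1) => M i j)).
    exact: smooth_on_differentiable fO Op.
  exact: differentiable_coord.
exists (fun q => 'D_v f q i j).
  by exists ('D_v f) => //; exact: smooth_on_derive.
by move=> p Op; exact/derive_coord/(smooth_on_differentiable fO).
Qed.

Lemma derive_comp_rV (R : realType) (V : normedModType R) (n : nat)
    (f : V -> 'rV[R]_n.+1) (g : 'rV[R]_n.+1 -> R) (p v : V) :
  differentiable f p -> differentiable g (f p) ->
  'D_v (g \o f) p =
    \sum_i 'D_v (fun q => f q 0 i) p * 'D_(delta_mx 0 i) g (f p).
Proof.
move=> df dg; rewrite deriveE; last exact: differentiable_comp.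
rewrite diff_comp//= [X in 'd g _ X]row_sum_delta linear_sum.
apply: eq_bigr => i _; by rewrite linearZ /= derive_coord// !deriveE.
Qed.

(** A syntactic invariant for [smooth_on_coind]. [SmoothComp] takes smooth maps rather than
    expressions, with an inner map into row vectors, so that the chain rule again yields a finite
    sum of products of constructors. *)
Inductive smooth_expr (R : realType) (V : normedModType R) (O : set V) :
    (V -> R) -> Prop :=
| SmoothBase f of smooth_on O f : smooth_expr O f
| SmoothCst c : smooth_expr O (cst c)
| SmoothAdd f g of smooth_expr O f & smooth_expr O g :
    smooth_expr O (fun q => f q + g q)
| SmoothMul f g of smooth_expr O f & smooth_expr O g :
    smooth_expr O (fun q => f q * g q)
| SmoothInv f of smooth_expr O f & (forall q, O q -> f q != 0) :
    smooth_expr O (fun q => (f q)^-1)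
| SmoothComp n (N : set 'rV[R]_n.+1) (f : V -> 'rV[R]_n.+1) g of
    (forall q, O q -> N (f q)) & smooth_on O f & smooth_on N g :
    smooth_expr O (g \o f).

Lemma smooth_expr_sum (R : realType) (V : normedModType R) (O : set V)
    (I : Type) (r : seq I) (F : I -> V -> R) :
  (forall i, smooth_expr O (F i)) -> smooth_expr O (fun q => \sum_(i <- r) F i q).
Proof.
move=> FO; elim: r => [|i r IH].
  rewrite (_ : (fun _ => _) = cst 0); [exact: SmoothCst|].
  by apply/funext => q; rewrite big_nil.
rewrite (_ : (fun _ => _) = fun q => F i q + \sum_(i <- r) F i q).
  exact: SmoothAdd.
by apply/funext => q; rewrite big_cons.
Qed.

(* Every derivative of an expression is again an expression, so smoothness
   follows from [smooth_on_coind]. *)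
Lemma smooth_expr_smooth_on (R : realType) (V : normedModType R) (O : set V)
    (f : V -> R) : open O -> smooth_expr O f -> smooth_on O f.
Proof.
move=> oO; move: f; apply: (smooth_on_coind (P := smooth_expr O)) => // f.
elim: f / => [f fO|c|f g _ [df Df] _ [dg Dg]|f g fO [df Df] gO [dg Dg]
  |f fO [df Df] f0|n N f g fN fO gN].
- split=> [p|v]; first exact: smooth_on_differentiable.
  by exists ('D_v f) => //; exact/SmoothBase/smooth_on_derive.
- split=> [p _|v]; first exact: differentiable_cst.
  by exists (cst 0) => [|p _]; [exact: SmoothCst|exact: derive_cst].
- split=> [p Op|v]; first by apply: differentiableD; [exact: df|exact: dg].
  have [f' f'O ff'] := Df v; have [g' g'O gg'] := Dg v.
  exists (fun q => f' q + g' q) => [|p Op]; first exact: SmoothAdd.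
  by rewrite -ff'// -gg'// deriveD//; apply/diff_derivable; [exact: df|exact: dg].
- split=> [p Op|v]; first by apply: differentiableM; [exact: df|exact: dg].
  have [f' f'O ff'] := Df v; have [g' g'O gg'] := Dg v.
  exists (fun q => f q * g' q + g q * f' q) => [|p Op].
    by apply: SmoothAdd; exact: SmoothMul.
  by rewrite -ff'// -gg'// deriveM//; apply/diff_derivable; [exact: df|exact: dg].
- split=> [p Op|v]; first by apply: differentiableV; [exact: df|exact: f0].
  have [f' f'O ff'] := Df v.
  exists (fun q => (-1 * ((f q)^-1 * (f q)^-1)) * f' q) => [|p Op].
    apply: (SmoothMul (SmoothMul (SmoothCst _ (-1)) _)) => //.
    by apply: SmoothMul; exact: SmoothInv.
  rewrite deriveV; [|exact: f0|exact/diff_derivable/df].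
  by rewrite ff'// mulN1r -invfM.
- split=> [p Op|v].
    apply: differentiable_comp; first exact: smooth_on_differentiable fO Op.
    exact: smooth_on_differentiable gN (fN _ Op).
  exists (fun q => \sum_i 'D_v (fun q => f q 0 i) q * 'D_(delta_mx 0 i) g (f q)).
    apply: smooth_expr_sum => i; apply: SmoothMul.
      exact/SmoothBase/smooth_on_derive/smooth_on_coord.
    by apply: (SmoothComp (g := 'D_(delta_mx 0 i) g) fN fO); exact: smooth_on_derive.
  move=> p Op; apply: derive_comp_rV.
    exact: smooth_on_differentiable fO Op.
  exact: smooth_on_differentiable gN (fN _ Op).
Qed.

Lemma smooth_on_cst (R : realType) (V : normedModType R) (O : set V) (c : R) :
  open O -> smooth_on O (fun=> c).
Proof. by move=> oO; exact/smooth_expr_smooth_on/SmoothCst. Qed.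

Lemma smooth_onD (R : realType) (V : normedModType R) (O : set V) (f g : V -> R) :
  open O -> smooth_on O f -> smooth_on O g -> smooth_on O (fun q => f q + g q).
Proof.
move=> oO fO gO; apply: smooth_expr_smooth_on => //.
by apply: SmoothAdd; exact: SmoothBase.
Qed.

Lemma smooth_onM (R : realType) (V : normedModType R) (O : set V) (f g : V -> R) :
  open O -> smooth_on O f -> smooth_on O g -> smooth_on O (fun q => f q * g q).
Proof.
move=> oO fO gO; apply: smooth_expr_smooth_on => //.
by apply: SmoothMul; exact: SmoothBase.
Qed.

Lemma smooth_onV (R : realType) (V : normedModType R) (O : set V) (f : V -> R) :
  open O -> smooth_on O f -> (forall q, O q -> f q != 0) ->
  smooth_on O (fun q => (f q)^-1).
Proof.
move=> oO fO f0; apply: smooth_expr_smooth_on => //.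
by apply: SmoothInv => //; exact: SmoothBase.
Qed.

Lemma smooth_on_comp (R : realType) (V : normedModType R) (n : nat) (O : set V)
    (N : set 'rV[R]_n.+1) (f : V -> 'rV[R]_n.+1) (g : 'rV[R]_n.+1 -> R) :
  open O -> (forall q, O q -> N (f q)) -> smooth_on O f -> smooth_on N g ->
  smooth_on O (fun q => g (f q)).
Proof.
by move=> oO fN fO gN; apply: smooth_expr_smooth_on => //; exact: SmoothComp gN.
Qed.

Lemma continuous_fst (U V : topologicalType) : continuous (@fst U V).
Proof. by move=> [a b]; exact: cvg_fst. Qed.

(** The difference quotient along [v] of [f] composed with the projection is literally that of [f]
    along [v.1], so iterated derivatives pull back. This serves for weights on jet space that depend
    on the base point only. *)
Lemma smooth_on_fst (R : realType) (V V' : normedModType R) (O : set V)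
    (f : V -> R) :
  smooth_on O f -> smooth_on (O \o fst) (fun q : V * V' => f q.1).
Proof.
move=> fO l p Op.
have -> : foldr (fun v g => fun q => 'D_v g q) (fun q : V * V' => f q.1) l =
    foldr (fun v g => fun q => 'D_v g q) f (map fst l) \o fst.
  by elim: l => //= v l ->.
apply: differentiable_comp; last exact: fO.
by apply: linear_differentiable => q; exact: continuous_fst.
Qed.

(** * Mean values and symmetry of mixed derivatives *)

Lemma is_derive_line (R : realType) (V W : normedModType R) (f : V -> W)
    (v a : V) (s : R) :
  derivable f (s *: v + a) v ->
  is_derive s 1 (fun t => f (t *: v + a)) ('D_v f (s *: v + a)).
Proof.
have E : (fun h : R => h^-1 *: (((fun t => f (t *: v + a)) \o shift s) (h *: 1)
           - f (s *: v + a))) =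
    (fun h => h^-1 *: ((f \o shift (s *: v + a)) (h *: v) - f (s *: v + a))).
  by apply/funext => h /=; rewrite [h *: 1]mulr1 scalerDl addrA.
by move=> df; split; rewrite /derivable /derive E.
Qed.

Lemma MVT_line (R : realType) (V : normedModType R) (f : V -> R) (v a : V)
    (r : R) : 0 < r ->
  (forall s, 0 <= s <= r -> differentiable f (s *: v + a)) ->
  exists2 s, 0 < s < r & f (r *: v + a) - f a = 'D_v f (s *: v + a) * r.
Proof.
move=> r0 df.
have dl s : 0 <= s <= r ->
    is_derive s 1 (fun t => f (t *: v + a)) ('D_v f (s *: v + a)).
  by move=> /df ?; apply/is_derive_line/diff_derivable.
have dlo s : s \in `]0, r[ ->
    is_derive s 1 (fun t => f (t *: v + a)) ('D_v f (s *: v + a)).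
  by rewrite in_itv => /andP[/ltW s0 /ltW sr]; apply: dl; rewrite s0.
have [|s] := MVT r0 dlo.
  apply: derivable_within_continuous => s; rewrite in_itv /= => /dl.
  by case.
by rewrite in_itv /= scale0r add0r subr0; exists s.
Qed.

(** The mean value theorem is applied twice: along [v] to [g q = f (r *: w + q) - f q], then along
    [w] to ['D_v f]. The left side is symmetric in [v] and [w], which is what makes mixed
    derivatives comparable. *)
Lemma second_difference (R : realType) (V : normedModType R) (O : set V)
    (f : V -> R) (v w p : V) (r : R) : 0 < r -> smooth_on O f ->
  (forall s t, 0 <= s <= r -> 0 <= t <= r -> O (s *: v + (t *: w + p))) ->
  exists s t, [/\ 0 < s < r, 0 < t < r &
    f (r *: v + (r *: w + p)) - f (r *: v + p) - (f (r *: w + p) - f p) =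
    'D_w ('D_v f) (s *: v + (t *: w + p)) * r * r].
Proof.
move=> r0 fO sq.
have r01 : 0 <= r <= r by rewrite ltW/=.
have z01 : 0 <= (0 : R) <= r by rewrite lexx ltW.
have sq0 s : 0 <= s <= r -> O (s *: v + p).
  by move=> sr; have := sq s 0 sr z01; rewrite scale0r add0r.
pose g q := f (r *: w + q) - f q.
have dsh q : differentiable (fun q => r *: w + q) q by [].
have dfw q : O (r *: w + q) -> differentiable (fun q => f (r *: w + q)) q.
  move=> Oq; apply: (differentiable_comp (dsh q)).
  exact: smooth_on_differentiable fO Oq.
have Dfw q : 'D_v (fun q => f (r *: w + q)) q = 'D_v f (r *: w + q).
  rewrite /derive [X in X @ _](_ : _ =
      fun h => h^-1 *: ((f \o shift (r *: w + q)) (h *: v) - f (r *: w + q)))//.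
  by apply/funext => h /=; rewrite addrCA.
have dg s : 0 <= s <= r -> differentiable g (s *: v + p).
  move=> sr; apply: differentiableB.
    by apply: dfw; rewrite addrCA; apply: sq.
  by apply: (smooth_on_differentiable fO); apply: sq0.
have [s sr gs] := MVT_line r0 dg.
have sr' : 0 <= s <= r by case/andP: sr => /ltW -> /ltW.
have dDf t : 0 <= t <= r -> differentiable ('D_v f) (t *: w + (s *: v + p)).
  move=> tr; rewrite addrCA.
  by apply: (smooth_on_differentiable (smooth_on_derive v fO)); apply: sq.
have [t tr Dt] := MVT_line r0 dDf.
exists s, t; split=> //.
rewrite [s *: v + (t *: w + p)]addrCA -Dt -Dfw.
transitivity (g (r *: v + p) - g p); first by rewrite /g addrCA; ring.
rewrite gs deriveB//.
  apply: diff_derivable; apply: dfw; rewrite addrCA; apply: sq => //.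
exact: smooth_on_derivable fO (sq0 _ sr').
Qed.

Lemma near_square (R : realType) (V : normedModType R) (A : set V) (v w p : V) :
  nbhs p A -> exists2 r : R, 0 < r & forall s t,
    0 <= s <= r -> 0 <= t <= r -> A (s *: v + (t *: w + p)).
Proof.
move=> /nbhs_normP[e /= e0 eA].
have n0 : 0 < `|v| + `|w| + 1 by rewrite ltr_wpDl// addr_ge0.
(* The summand 1 keeps the denominator positive when [v] and [w] vanish. It also makes the final
   estimate strict: with [r] the chosen radius, the displacement has norm at most r(|v| + |w|) = e -
   r. *)
exists (e / (`|v| + `|w| + 1)); first exact: divr_gt0.
move=> s t /andP[s0 sr] /andP[t0 tr]; apply: eA => /=.
rewrite addrA opprD addrCA subrr addr0 normrN.
rewrite (le_lt_trans (ler_normD _ _))// !normrZ !ger0_norm//.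
have := ler_wpM2r (normr_ge0 v) sr; have := ler_wpM2r (normr_ge0 w) tr.
have : e / (`|v| + `|w| + 1) * (`|v| + `|w| + 1) = e by rewrite divfK ?gt_eqF.
have : 0 < e / (`|v| + `|w| + 1) by exact: divr_gt0.
by lra.
Qed.

(** Both orders of mean values represent the same second difference over a small square, so the two
    mixed derivatives agree at two points near [p]. Continuity transfers this to [p] up to any
    [e]. *)
Lemma derive_comm (R : realType) (V : normedModType R) (O : set V) (f : V -> R)
    (v w p : V) : open O -> O p -> smooth_on O f ->
  'D_w ('D_v f) p = 'D_v ('D_w f) p.
Proof.
move=> oO Op fO; apply/eqP; rewrite -subr_eq0 -normr_le0.
apply/ler_addgt0Pl => e e0; rewrite addr0.
have cts (g : V -> R) : smooth_on O g -> \forall q \near p, `|g p - g q| < e / 2.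
  move=> gO; have e20 : 0 < e / 2 by rewrite divr_gt0.
  have /cvgrPdist_lt : {for p, continuous g}.
    exact/differentiable_continuous/(smooth_on_differentiable gO).
  by apply.
have Dvw : smooth_on O ('D_w ('D_v f)) by do 2 apply: smooth_on_derive.
have Dwv : smooth_on O ('D_v ('D_w f)) by do 2 apply: smooth_on_derive.
have [r r0 sq] := near_square v w
  (filterI (open_nbhs_nbhs (conj oO Op)) (filterI (cts _ Dvw) (cts _ Dwv))).
have in01 s : 0 < s < r -> 0 <= s <= r by case/andP => /ltW -> /ltW ->.
have [|s [t [/in01 sr /in01 tr E1]]] :=
    second_difference (v := v) (w := w) (p := p) r0 fO.
  by move=> s t sr tr; have [] := sq s t sr tr.
have [|t' [s' [/in01 tr' /in01 sr' E2]]] :=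
    second_difference (v := w) (w := v) (p := p) r0 fO.
  by move=> s' t' sr' tr'; rewrite addrCA; have [] := sq t' s' tr' sr'.
have := sq s' t' sr' tr'; rewrite addrCA => -[_ [_ E3]].
have [_ [E4 _]] := sq s t sr tr.
move: E1 E2 E3 E4; rewrite [r *: w + (_ + _)]addrCA.
set a := ('D_w ('D_v f) p); set b := ('D_v ('D_w f) p).
set c := ('D_w ('D_v f) (s *: v + (t *: w + p))).
set d := ('D_v ('D_w f) (t' *: w + (s' *: v + p))).
clearbody a b c d => E1 E2 bd ac.
have dc : d = c.
  have rr : r * r != 0 by rewrite mulf_neq0 ?gt_eqF.
  by apply/eqP; rewrite -(inj_eq (mulIf rr)) !mulrA -E1 -E2; apply/eqP; ring.
rewrite dc in bd.
rewrite (_ : a - b = (a - c) - (b - c)); last by ring.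
by rewrite (le_trans (ler_normB _ _))// [leRHS]splitr lerD// ltW.
Qed.

(** * Functions vanishing to finite order at a point *)

(** For smooth [f] this says that the [k]-jet of [f] at [p] is zero. Using all directions, and not
    only the coordinate ones, makes it coordinate-free and lets inductions peel off the innermost
    derivative. *)
Definition flat (R : realType) (V : normedModType R) (k : nat) (f : V -> R)
    (p : V) : Prop :=
  forall l : seq V, (size l <= k)%N ->
    foldr (fun v g => fun q => 'D_v g q) f l p = 0.

Lemma flatS (R : realType) (V : normedModType R) (k : nat) (f : V -> R) (p : V) :
  flat k.+1 f p <-> f p = 0 /\ forall v, flat k ('D_v f) p.
Proof.
split=> [fk|[f0 fk] l].
  split=> [|v l lk]; first exact: (fk [::]).
  by have := fk (rcons l v); rewrite size_rcons foldr_rcons; exact.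
case/lastP: l => [|l v] //; rewrite size_rcons foldr_rcons.
exact: (fk v l).
Qed.

Lemma flat_eq0 (R : realType) (V : normedModType R) (k : nat) (f : V -> R) (p : V) :
  flat k f p -> f p = 0.
Proof. by move/(_ [::]); exact. Qed.

Lemma flatW (R : realType) (V : normedModType R) (j k : nat) (f : V -> R) (p : V) :
  (j <= k)%N -> flat k f p -> flat j f p.
Proof. by move=> jk fk l lj; apply: fk; exact: leq_trans jk. Qed.

Lemma eq_flat (R : realType) (V : normedModType R) (k : nat) (O : set V)
    (f g : V -> R) (p : V) :
  open O -> O p -> (forall q, O q -> f q = g q) -> flat k f p -> flat k g p.
Proof.
move=> oO Op; elim: k f g => [|k IH] f g fg.
  by move=> fk [|//] _; rewrite -[LHS]/(g p) -fg//; exact: flat_eq0 fk.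
case/flatS => f0 fk; apply/flatS; split=> [|v]; first by rewrite -fg.
by apply: IH (fk v) => q Oq; exact: eq_on_derive oO fg Oq.
Qed.

Lemma flatD (R : realType) (V : normedModType R) (k : nat) (O : set V)
    (f g : V -> R) (p : V) : open O -> O p -> smooth_on O f -> smooth_on O g ->
  flat k f p -> flat k g p -> flat k (fun q => f q + g q) p.
Proof.
move=> oO Op; elim: k f g => [|k IH] f g fO gO.
  move=> fk gk [|//] _.
  by rewrite -[LHS]/(f p + g p) (flat_eq0 fk) (flat_eq0 gk) addr0.
move=> /flatS[f0 fk] /flatS[g0 gk]; apply/flatS; split=> [|v].
  by rewrite f0 g0 addr0.
apply: (@eq_flat _ _ _ O (fun q => 'D_v f q + 'D_v g q)) => //.
  by move=> q Oq; rewrite deriveD//; apply: smooth_on_derivable Oq.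
by apply: IH => //; exact: smooth_on_derive.
Qed.

(** In the Leibniz rule [g * 'D_v f + 'D_v g * f], the derivative of [f] is flat to one order less,
    and [f] itself is a fortiori flat to that order. The induction is therefore generalised over the
    cofactor [g]. *)
Lemma flatM (R : realType) (V : normedModType R) (k : nat) (O : set V)
    (f g : V -> R) (p : V) : open O -> O p -> smooth_on O f -> smooth_on O g ->
  flat k f p -> flat k (fun q => g q * f q) p.
Proof.
move=> oO Op; elim: k f g => [|k IH] f g fO gO fk.
  by move=> [|//] _; rewrite -[LHS]/(g p * f p) (flat_eq0 fk) mulr0.
apply/flatS; split=> [|v]; first by rewrite (flat_eq0 fk) mulr0.
apply: (@eq_flat _ _ _ O (fun q => g q * 'D_v f q + 'D_v g q * f q)) => //.
  move=> q Oq; rewrite deriveM;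
    [|exact: smooth_on_derivable gO Oq|exact: smooth_on_derivable fO Oq].
  by rewrite [f q *: _]mulrC.
apply: (flatD oO) => //; try by apply: smooth_onM => //; exact: smooth_on_derive.
  by apply: IH => //; [exact: smooth_on_derive|have [_] := (flatS _ _ _).1 fk].
by apply: IH => //; [exact: smooth_on_derive|exact: flatW fk].
Qed.

Lemma smooth_on_sum (R : realType) (V : normedModType R) (O : set V)
    (I : Type) (r : seq I) (F : I -> V -> R) : open O ->
  (forall i, smooth_on O (F i)) -> smooth_on O (fun q => \sum_(i <- r) F i q).
Proof.
by move=> oO FO; apply/smooth_expr_smooth_on/smooth_expr_sum => // i; exact: SmoothBase.
Qed.

Lemma flat_sum (R : realType) (V : normedModType R) (k : nat) (O : set V)
    (I : Type) (r : seq I) (F : I -> V -> R) (p : V) : open O -> O p ->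
  (forall i, smooth_on O (F i)) -> (forall i, flat k (F i) p) ->
  flat k (fun q => \sum_(i <- r) F i q) p.
Proof.
move=> oO Op FO Fk; elim: r => [|i r IH].
  under eq_fun do rewrite big_nil.
  elim: k {Fk} => [|k IH]; first by case.
  apply/flatS; split=> // v; apply: eq_flat oO Op _ IH => q _.
  by rewrite derive_cst.
under eq_fun do rewrite big_cons.
by apply: (flatD oO) => //; exact: smooth_on_sum.
Qed.

(** Every summand of the chain rule has a factor ['D_(delta_mx 0 i) g] composed with [f], flat to
    one order less by induction; [flatM] absorbs the other factor. *)
Lemma flat_comp (R : realType) (V : normedModType R) (n k : nat) (O : set V)
    (N : set 'rV[R]_n.+1) (f : V -> 'rV[R]_n.+1) (g : 'rV[R]_n.+1 -> R) (p : V) :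
  open O -> O p -> (forall q, O q -> N (f q)) -> smooth_on O f -> smooth_on N g ->
  flat k g (f p) -> flat k (fun q => g (f q)) p.
Proof.
move=> oO Op fN fO; elim: k g => [|k IH] g gN gk.
  by move=> [|//] _; exact: flat_eq0 gk.
apply/flatS; split=> [|v]; first exact: flat_eq0 gk.
apply: (@eq_flat _ _ _ O (fun q => \sum_i 'D_v (fun q => f q 0 i) q *
    'D_(delta_mx 0 i) g (f q))) => //.
  move=> q Oq; rewrite -derive_comp_rV//.
    exact: smooth_on_differentiable fO Oq.
  exact: smooth_on_differentiable gN (fN _ Oq).
have Df i : smooth_on O ('D_v (fun q => f q 0 i)).
  by apply: smooth_on_derive; exact: smooth_on_coord fO.
have Dg i : smooth_on O (fun q => 'D_(delta_mx 0 i) g (f q)).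
  apply: (smooth_on_comp (g := 'D_(delta_mx 0 i) g) oO fN fO).
  exact: smooth_on_derive.
apply: (flat_sum _ oO) => // i; first exact: smooth_onM.
apply: (flatM oO) => //; apply: (IH ('D_(delta_mx 0 i) g)); first exact: smooth_on_derive.
by have [_] := (flatS _ _ _).1 gk.
Qed.

Lemma derive_rV_basis (R : realType) (n : nat) (f : 'rV[R]_n.+1 -> R)
    (p v : 'rV[R]_n.+1) : differentiable f p ->
  'D_v f p = \sum_i v 0 i * 'D_(delta_mx 0 i) f p.
Proof.
move=> df; rewrite deriveE// {1}(row_sum_delta v) linear_sum.
by apply: eq_bigr => i _; rewrite linearZ /= deriveE.
Qed.

(** On [O] any directional derivative is a combination of the basis ones with constant
    coefficients. *)
Lemma flatS_basis (R : realType) (n k : nat) (O : set 'rV[R]_n.+1)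
    (f : 'rV[R]_n.+1 -> R) (p : 'rV[R]_n.+1) : open O -> O p -> smooth_on O f ->
  f p = 0 -> (forall i, flat k ('D_(delta_mx 0 i) f) p) -> flat k.+1 f p.
Proof.
move=> oO Op fO f0 fk; apply/flatS; split=> // v.
apply: (@eq_flat _ _ _ O (fun q => \sum_i v 0 i * 'D_(delta_mx 0 i) f q)) => //.
  move=> q Oq; rewrite (@derive_rV_basis _ _ f q v)//.
  exact: smooth_on_differentiable fO Oq.
have Df i : smooth_on O ('D_(delta_mx 0 i) f) by exact: smooth_on_derive.
apply: (flat_sum _ oO) => // i.
  by apply: smooth_onM => //; exact: smooth_on_cst.
by apply: (flatM oO) => //; exact: smooth_on_cst.
Qed.

(** * Iterated derivatives, the three coordinates and jet coordinates *)

Notation Diter l w f := (iter l (fun g => fun q => 'D_w g q) f).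

Lemma foldr_nseq_iter (A B : Type) (f : A -> B -> B) (n : nat) (a : A) (b : B) :
  foldr f b (nseq n a) = iter n (f a) b.
Proof. by elim: n => //= n ->. Qed.

Lemma smooth_on_Diter (R : realType) (V : normedModType R) (O : set V)
    (f : V -> R) (l : nat) (w : V) : smooth_on O f -> smooth_on O (Diter l w f).
Proof. by move=> fO; elim: l => //= l; exact: smooth_on_derive. Qed.

Lemma eq_on_Diter (R : realType) (V : normedModType R) (O : set V)
    (f g : V -> R) (l : nat) (w : V) : open O -> (forall q, O q -> f q = g q) ->
  forall q, O q -> Diter l w f q = Diter l w g q.
Proof. by move=> oO fg; elim: l => //= l IH q; exact: eq_on_derive IH. Qed.

Lemma Diter_derive (R : realType) (V : normedModType R) (O : set V)
    (f : V -> R) (l : nat) (v w : V) : open O -> smooth_on O f ->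
  forall q, O q -> Diter l w ('D_v f) q = 'D_v (Diter l w f) q.
Proof.
move=> oO fO; elim: l => //= l IH q Oq.
rewrite (eq_on_derive w oO IH Oq).
by apply: derive_comm oO Oq _; exact: smooth_on_Diter.
Qed.

Lemma ord3P (P : 'I_3 -> Prop) : P iu -> P ix -> P iv -> forall i, P i.
Proof.
move=> Pu Px Pv [[|[|[|//]]] i3].
- by rewrite (_ : Ordinal i3 = iu)//; exact: val_inj.
- by rewrite (_ : Ordinal i3 = ix)//; exact: val_inj.
- by rewrite (_ : Ordinal i3 = iv)//; exact: val_inj.
Qed.

Lemma sum_ord3 (V : nmodType) (F : 'I_3 -> V) :
  \sum_i F i = F iu + F ix + F iv.
Proof.
rewrite !big_ord_recr big_ord0 /= add0r.
by congr (F _ + F _ + F _); exact: val_inj.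
Qed.

Lemma flat_partial_eq0 (R : realType) (k i j l : nat) (f : 'rV[R]_3 -> R)
    (p : 'rV[R]_3) : (i + j + l <= k)%N -> flat k f p -> partial i j l f p = 0.
Proof.
move=> ijl /(_ (nseq i (delta_mx 0 iu) ++ nseq j (delta_mx 0 ix) ++
                nseq l (delta_mx 0 iv))).
by rewrite !size_cat !size_nseq addnA !foldr_cat !foldr_nseq_iter => /(_ ijl).
Qed.

(* The vanishing of the derivatives taken in the order of [partial] suffices,
   by the symmetry of mixed derivatives. *)
Lemma partial_eq0_flat (R : realType) (k : nat) (O : set 'rV[R]_3)
    (f : 'rV[R]_3 -> R) (p : 'rV[R]_3) : open O -> O p -> smooth_on O f ->
  (forall i j l, (i + j + l <= k)%N -> partial i j l f p = 0) -> flat k f p.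
Proof.
move=> oO Op; elim: k f => [|k IH] f fO f0.
  by move=> [|//] _; exact: (f0 0 0 0)%N.
apply: (flatS_basis oO) => //; first exact: (f0 0 0 0)%N.
apply: ord3P; (apply: IH => [|i j l ijl]; first exact: smooth_on_derive).
- have := f0 i.+1 j l; rewrite !addSn ltnS => /(_ ijl).
  rewrite /partial iterSr; congr (_ = _); apply: (eq_on_Diter _ _ oO) => // q Oq.
  rewrite -(Diter_derive _ _ _ oO)//; last exact: smooth_on_Diter.
  apply: (eq_on_Diter _ _ oO) => // r Or.
  by rewrite -(Diter_derive _ _ _ oO).
- have := f0 i j.+1 l; rewrite addnS !addSn ltnS => /(_ ijl).
  rewrite /partial iterSr; congr (_ = _); apply: (eq_on_Diter _ _ oO) => // q Oq.
  apply: (eq_on_Diter _ _ oO) => // r Or.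
  by rewrite -(Diter_derive _ _ _ oO).
- have := f0 i j l.+1; rewrite addnS ltnS => /(_ ijl).
  by rewrite /partial iterSr.
Qed.

(** The bound on the order puts the multi-index in [midx k], so the sum defining [jcoord] has
    exactly one term rather than none. *)
Lemma jcoord_jet_of (R : realType) (k : nat) (s : 'rV[R]_3 -> 'rV[R]_3)
    (p : 'rV[R]_3) (a : 'I_3) (i j l : nat) : (i + j + l <= k)%N ->
  jcoord a i j l (jet_of k s p) = partial i j l (fun q => s q 0 a) p.
Proof.
move=> ijl; have ik : (i < k.+1)%N by lia.
have jk : (j < k.+1)%N by lia.
have lk : (l < k.+1)%N by lia.
pose I : midx k := exist _ (Ordinal ik, Ordinal jk, Ordinal lk) ijl.
rewrite /jcoord (big_pred1 I) /=; first by rewrite mxE enum_rankK.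
move=> [[[i' j'] l'] ijl'] /=; rewrite -val_eqE /= -!pair_eqE /= -!val_eqE /=.
by rewrite andbA.
Qed.

(** * Jacobian of a pseudogroup element and transformation law of the metric coefficients *)

Notation e_u := (delta_mx 0 iu).
Notation e_x := (delta_mx 0 ix).
Notation e_v := (delta_mx 0 iv).

(** A directional derivative depends only on the values along one line near parameter 0, so
    functions on different spaces can be compared. It relates components of [phi] to [C] and [A],
    defined on [R] and [R * R]. *)
Lemma eq_derive_along (R : realType) (V V' W : normedModType R) (f : V -> W)
    (g : V' -> W) (q w : V) (r z : V') :
  (\forall h \near (0 : R), f (h *: w + q) = g (h *: z + r)) ->
  'D_w f q = 'D_z g r.
Proof.
move=> fg; have := nbhs_singleton fg; rewrite !scale0r !add0r => fg0.
rewrite /derive; congr (lim _); rewrite eqEsubset.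
by split; apply/near_eq_cvg/cvg_within; apply: filterS fg => h /= ->; rewrite fg0.
Qed.

Lemma near_line (R : realType) (V : normedModType R) (U : set V) (q w : V) :
  open U -> U q -> \forall h \near (0 : R), U (h *: w + q).
Proof.
move=> oU Uq.
have : (fun h : R => h *: w + q) @ (0 : R) --> (0 : R) *: w + q.
  by apply: cvgD; [apply: cvgZr_tmp; exact: cvg_id|exact: cvg_cst].
rewrite scale0r add0r; apply.
exact: open_nbhs_nbhs.
Qed.

(** Along a coordinate line the normal form turns a component of [phi] into a constant, an affine
    function, or a restriction of [C] or [A]. These relations are all that is used of the normal
    form afterwards. *)
Lemma pseudogroup_jacobian (R : realType) (U : set 'rV[R]_3)
    (phi : 'rV[R]_3 -> 'rV[R]_3) (q : 'rV[R]_3) : in_pseudogroup U phi -> U q ->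
  let d a w := 'D_w (fun r => phi r 0 a) q in
  [/\ d iu e_u != 0, d ix e_x != 0, d iv e_v = (d iu e_u)^-1 &
      [/\ d iu e_x = 0, d iu e_v = 0 & d ix e_v = 0]].
Proof.
move=> [[oU _ _ _] [C [A [B [_ _ _ H]]]]] Uq d.
have nl (w : 'rV[R]_3) := near_line w oU Uq.
have [C0 A0 _ _ _] := H _ Uq.
have duu : d iu e_u = derive1 C (q 0 iu).
  rewrite derive1E; apply: eq_derive_along; apply: filterS (nl e_u) => h Uh.
  by have [_ _ -> _ _] := H _ Uh; rewrite !mxE; congr (C _).
have co w (h : R) a : (h *: w + q) 0 a = h * w 0 a + q 0 a by rewrite !mxE.
have e00 (a b : 'I_3) : a != b -> (delta_mx 0 a : 'rV[R]_3) 0 b = 0.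
  by move=> ab; rewrite mxE eqxx /= eq_sym (negbTE ab).
have e11 (a : 'I_3) : (delta_mx 0 a : 'rV[R]_3) 0 a = 1 by rewrite mxE !eqxx.
have dxx : d ix e_x = 'D_(0, 1) A (q 0 iu, q 0 ix).
  apply: eq_derive_along; apply: filterS (nl e_x) => h Uh.
  have [_ _ _ -> _] := H _ Uh; rewrite !co e00// e11 mulr0; congr (A (_, _)).
  by rewrite -[RHS]/(h * 0 + q 0 iu) mulr0.
have dux : d iu e_x = 0.
  rewrite -[RHS](derive_cst (C (q 0 iu)) q e_x).
  apply: eq_derive_along; apply: filterS (nl e_x) => h Uh.
  by have [_ _ -> _ _] := H _ Uh; rewrite co e00// mulr0 add0r.
have duv : d iu e_v = 0.
  rewrite -[RHS](derive_cst (C (q 0 iu)) q e_v).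
  apply: eq_derive_along; apply: filterS (nl e_v) => h Uh.
  by have [_ _ -> _ _] := H _ Uh; rewrite co e00// mulr0 add0r.
have dxv : d ix e_v = 0.
  rewrite -[RHS](derive_cst (A (q 0 iu, q 0 ix)) q e_v).
  apply: eq_derive_along; apply: filterS (nl e_v) => h Uh.
  by have [_ _ _ -> _] := H _ Uh; rewrite !co !e00// !mulr0 !add0r.
have dvv : d iv e_v = (derive1 C (q 0 iu))^-1.
  (* [b] is the value of the third component of [phi] at [q]. Along the v-line that component is
     affine, with slope [(derive1 C (q 0 iu))^-1]. *)
  pose b := q 0 iv / derive1 C (q 0 iu) + B (q 0 iu, q 0 ix).
  have dk : is_derive (0 : R) 1 (fun t : R => (derive1 C (q 0 iu))^-1 *: t + b)
      (derive1 C (q 0 iu))^-1.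
    by apply: is_derive_eq; rewrite addr0 [LHS]mulr1.
  rewrite -(derive_val (is_derive := dk)).
  apply: eq_derive_along; apply: filterS (nl e_v) => h Uh.
  have [_ _ _ _ ->] := H _ Uh; rewrite !co (e00 iv iu)// (e00 iv ix)//.
  rewrite e11 !mulr0 !add0r mulr1 addr0.
  by rewrite [h *: 1]mulr1 /b mulrDl addrA [h / _]mulrC.
by rewrite duu dxx dvv.
Qed.

Notation dphi phi a w := (fun q => 'D_w (fun r => phi r 0 a) q).

(** Three test vectors determine the quadratic form: [e_x] isolates h, [e_u] isolates H, and
    [e_u + e_x] then gives W by polarization. *)
Lemma acts0E (R : realType) (U : set 'rV[R]_3) (phi : 'rV[R]_3 -> 'rV[R]_3)
    (q w w' : 'rV[R]_3) : in_pseudogroup U phi -> U q -> acts0 phi q w w' ->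
  let d a w := dphi phi a w q in
  [/\ w 0 ih = d ix e_x ^+ 2 * w' 0 ih,
      w 0 iW = d iu e_u * d iv e_x + (d iu e_u * d ix e_x * w' 0 iW +
               2 * d ix e_u * d ix e_x * w' 0 ih) &
      w 0 iH = d iu e_u * d iv e_u + (d iu e_u ^+ 2 * w' 0 iH +
               (d iu e_u * d ix e_u * w' 0 iW + d ix e_u ^+ 2 * w' 0 ih))].
Proof.
move=> gphi Uq act d.
have dphiE a X : 'd phi q X 0 a = d a X.
  have dq : differentiable phi q.
    by case: gphi => -[_ _ phiU _] _; exact: smooth_on_differentiable phiU Uq.
  by rewrite /d derive_coord// deriveE.
have dux : d iu e_x = 0 by have [_ _ _ []] := pseudogroup_jacobian gphi Uq.
have e00 (a b : 'I_3) : a != b -> (delta_mx 0 a : 'rV[R]_3) 0 b = 0.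
  by move=> ab; rewrite mxE eqxx /= eq_sym (negbTE ab).
have e11 (a : 'I_3) : (delta_mx 0 a : 'rV[R]_3) 0 a = 1 by rewrite mxE !eqxx.
have addE (X Y : 'rV[R]_3) a : (X + Y) 0 a = X 0 a + Y 0 a by rewrite mxE.
have := act e_u; have := act e_x; have := act (e_u + e_x).
rewrite /kundt linearD !addE !dphiE dux.
rewrite !e11 !(e00 iu ix)// !(e00 iu iv)// !(e00 ix iu)// !(e00 ix iv)//.
move: (d iu e_u) (d ix e_u) (d iv e_u) (d ix e_x) (d iv e_x).
move: (w 0 ih) (w 0 iW) (w 0 iH) (w' 0 ih) (w' 0 iW) (w' 0 iH).
move=> h W H h' W' H' P T Z Q S E1 E2 E3.
have {}E2 : h = Q ^+ 2 * h' by move: E2; lra.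
have {}E3 : H = P * Z + (P ^+ 2 * H' + (P * T * W' + T ^+ 2 * h')).
  by move: E3; lra.
split=> //; move: E1; rewrite E2 E3; lra.
Qed.

(** * Derivatives along v and composition with pseudogroup elements *)

(** These are the coefficients that pass through v-derivatives. The condition is a vanishing
    derivative rather than independence of the third coordinate, since a line in that direction may
    meet [N] in several pieces. *)
Definition v_const (R : realType) (N : set 'rV[R]_3) (c : 'rV[R]_3 -> R) : Prop :=
  smooth_on N c /\ forall q, N q -> 'D_e_v c q = 0.

Lemma v_constS (R : realType) (U N : set 'rV[R]_3) (c : 'rV[R]_3 -> R) :
  N `<=` U -> v_const U c -> v_const N c.
Proof. by move=> NU [cU Dc]; split=> [|q /NU]; [exact: smooth_onS cU|exact: Dc]. Qed.

Lemma v_constM (R : realType) (N : set 'rV[R]_3) (c d : 'rV[R]_3 -> R) : open N ->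
  v_const N c -> v_const N d -> v_const N (fun q => c q * d q).
Proof.
move=> oN [cN Dc] [dN Dd]; split=> [|q Nq]; first exact: smooth_onM.
rewrite deriveM;
    [|exact: smooth_on_derivable cN Nq|exact: smooth_on_derivable dN Nq].
by rewrite Dc// Dd// !scaler0 addr0.
Qed.

Lemma v_constV (R : realType) (N : set 'rV[R]_3) (c : 'rV[R]_3 -> R) : open N ->
  (forall q, N q -> c q != 0) -> v_const N c -> v_const N (fun q => (c q)^-1).
Proof.
move=> oN c0 [cN Dc]; split=> [|q Nq]; first exact: smooth_onV.
by rewrite deriveV ?c0 ?Dc ?scaler0//; exact: smooth_on_derivable cN Nq.
Qed.

Lemma Diter_v_constM (R : realType) (N : set 'rV[R]_3) (c f : 'rV[R]_3 -> R)
    (l : nat) : open N -> v_const N c -> smooth_on N f ->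
  forall q, N q -> Diter l e_v (fun r => c r * f r) q = c q * Diter l e_v f q.
Proof.
move=> oN [cN Dc] fN; elim: l => //= l IH q Nq.
rewrite (eq_on_derive _ oN IH Nq).
have fNl : smooth_on N (Diter l e_v f) by exact: smooth_on_Diter.
rewrite deriveM;
    [|exact: smooth_on_derivable cN Nq|exact: smooth_on_derivable fNl Nq].
by rewrite Dc// scaler0 addr0.
Qed.

Lemma DiterD (R : realType) (V : normedModType R) (N : set V) (f g : V -> R)
    (l : nat) (w : V) : open N -> smooth_on N f -> smooth_on N g ->
  forall q, N q -> Diter l w (fun r => f r + g r) q = Diter l w f q + Diter l w g q.
Proof.
move=> oN fN gN; elim: l => //= l IH q Nq.
rewrite (eq_on_derive _ oN IH Nq) deriveD//.
  exact: smooth_on_derivable (smooth_on_Diter l w fN) Nq.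
exact: smooth_on_derivable (smooth_on_Diter l w gN) Nq.
Qed.

Lemma Diter0 (R : realType) (V : normedModType R) (N : set V) (f : V -> R)
    (l : nat) (w : V) : open N -> (forall q, N q -> f q = 0) ->
  forall q, N q -> Diter l w f q = 0.
Proof.
move=> oN f0 q Nq; rewrite (eq_on_Diter l w oN (g := cst 0) f0 Nq).
elim: l q {Nq} => //= l IH q; rewrite (_ : Diter l w _ = cst 0) ?derive_cst//.
exact/funext.
Qed.

Lemma pseudogroup_smooth_on (R : realType) (U : set 'rV[R]_3)
    (phi : 'rV[R]_3 -> 'rV[R]_3) (a : 'I_3) : in_pseudogroup U phi ->
  smooth_on U (fun q => phi q 0 a).
Proof. by move=> [[oU _ phiU _] _]; exact: smooth_on_coord. Qed.

(** Exchanging derivatives makes ['D_e_v] fall on [phi] first, which produces an entry equal to 0 or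
    to [(d iu e_u)^-1]. The last clause carries one more derivative because the u-derivative of v /
    C'(u) + B(u, x) is affine in v, not constant. *)
Lemma pseudogroup_v_const (R : realType) (U : set 'rV[R]_3)
    (phi : 'rV[R]_3 -> 'rV[R]_3) : in_pseudogroup U phi ->
  let d a w := dphi phi a w in
  [/\ v_const U (d iu e_u), v_const U (d ix e_x), v_const U (d ix e_u),
      v_const U (d iv e_x) & v_const U ('D_e_v (d iv e_u))].
Proof.
move=> gphi d; have oU : open U by case: gphi => -[].
have phiU a := pseudogroup_smooth_on a gphi.
have dU a w : smooth_on U (d a w) by exact: smooth_on_derive.
have comm a v w q : U q -> 'D_w (d a v) q = 'D_v (d a w) q.
  by move=> Uq; exact: derive_comm oU Uq (phiU a).
have zero g w q : (forall r, U r -> g r = 0) -> U q -> 'D_w g q = 0.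
  by move=> g0 Uq; rewrite (eq_on_derive w oU (g := cst 0) g0 Uq) derive_cst.
have jac := pseudogroup_jacobian gphi.
have du0 : forall q, U q -> d iu e_u q != 0 by move=> q /jac[].
have dux q : U q -> d iu e_x q = 0 by move=> /jac[_ _ _ []].
have duv q : U q -> d iu e_v q = 0 by move=> /jac[_ _ _ []].
have dxv q : U q -> d ix e_v q = 0 by move=> /jac[_ _ _ []].
have dvv q : U q -> d iv e_v q = (d iu e_u q)^-1 by move=> /jac[].
(* Since [d iv e_v] is the inverse of [d iu e_u] throughout [U], its derivatives vanish along with
   those of [d iu e_u]. *)
have inv_uu w q : U q -> 'D_w (d iu e_u) q = 0 ->
    'D_w (d iv e_v) q = 0.
  move=> Uq D0; rewrite (eq_on_derive w oU dvv Uq).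
  rewrite deriveV ?du0 ?D0 ?scaler0//; exact: smooth_on_derivable (dU _ _) Uq.
have uuv q : U q -> 'D_e_v (d iu e_u) q = 0.
  by move=> Uq; rewrite comm// zero.
split.
- by split; [exact: (dU iu e_u)|exact: uuv].
- split; first exact: (dU ix e_x).
  by move=> q Uq; rewrite comm// (zero _ _ _ _ dxv).
- split; first exact: (dU ix e_u).
  by move=> q Uq; rewrite comm// (zero _ _ _ _ dxv).
- split; first exact: (dU iv e_x).
  by move=> q Uq; rewrite comm// inv_uu// comm// (zero _ _ _ _ dux).
- split; first exact/smooth_on_derive/(dU iv e_u).
  move=> q Uq; rewrite (eq_on_derive e_v oU (comm iv e_u e_v) Uq).
  rewrite (derive_comm e_u e_v oU Uq (dU iv e_v)).
  by apply: zero Uq => r Ur; exact: inv_uu Ur (uuv _ Ur).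
Qed.

(** The chain rule for ['D_e_v] has a single nonzero term, with a factor that is constant along v
    and so passes out of the remaining derivatives. The induction peels off the innermost
    derivative, replacing [g] by ['D_e_v g]. *)
Lemma Diter_comp_pseudogroup (R : realType) (U N M : set 'rV[R]_3)
    (phi : 'rV[R]_3 -> 'rV[R]_3) (g : 'rV[R]_3 -> R) (l : nat) :
  in_pseudogroup U phi -> open N -> N `<=` U -> (forall q, N q -> M (phi q)) ->
  smooth_on M g -> forall q, N q ->
  Diter l e_v (fun r => g (phi r)) q =
    (dphi phi iu e_u q)^-1 ^+ l * Diter l e_v g (phi q).
Proof.
move=> gphi oN NU NM; have oU : open U by case: gphi => -[].
have phiN : smooth_on N phi by case: gphi => -[_ _ /(smooth_onS NU)].
have [[uuU Duu] _ _ _ _] := pseudogroup_v_const gphi.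
have vcP : v_const N (fun q => (dphi phi iu e_u q)^-1).
  apply: v_constV => // [q /NU /(pseudogroup_jacobian gphi)[]//|].
  by split=> [|q /NU]; [exact: smooth_onS uuU|exact: Duu].
elim: l g => [|l IH] g gM q Nq; first by rewrite expr0 mul1r.
have E r : N r -> 'D_e_v (fun r => g (phi r)) r =
    (dphi phi iu e_u r)^-1 * 'D_e_v g (phi r).
  move=> Nr; have [_ _ dvv [_ duv dxv]] := pseudogroup_jacobian gphi (NU _ Nr).
  rewrite (derive_comp_rV (g := g)).
  - by rewrite sum_ord3 duv dxv !mul0r !add0r dvv.
  - exact: smooth_on_differentiable phiN Nr.
  - exact: smooth_on_differentiable gM (NM _ Nr).
have DgM := smooth_on_derive e_v gM.
have DgN := smooth_on_comp (g := 'D_e_v g) oN NM phiN DgM.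
rewrite !iterSr (eq_on_Diter _ _ oN E)// (Diter_v_constM _ oN vcP DgN)//.
by rewrite (IH ('D_e_v g) DgM q Nq) exprSr mulrCA mulrA.
Qed.

(** Near [phi p] the function [g] is [g \o phi] composed with the smooth local inverse [psi], so
    [flat_comp] along [psi] applies. *)
Lemma flat_pseudogroup (R : realType) (k : nat) (U N M : set 'rV[R]_3)
    (phi : 'rV[R]_3 -> 'rV[R]_3) (g : 'rV[R]_3 -> R) (p : 'rV[R]_3) :
  in_pseudogroup U phi -> open N -> N `<=` U -> N p -> open M ->
  (forall q, N q -> M (phi q)) -> smooth_on M g ->
  flat k (fun r => g (phi r)) p -> flat k g (phi p).
Proof.
move=> [[oU oV phiU [psi psiV psiK]] _] oN NU Np oM NM gM fk.
have phiN := smooth_onS NU phiU.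
have Vp : [set phi x | x in U] (phi p) by exists p => //; exact: NU.
have nN : nbhs (phi p) (psi @^-1` N).
  have psic : {for phi p, continuous psi}.
    exact/differentiable_continuous/(smooth_on_differentiable psiV).
  by apply: psic; rewrite psiK; [exact: open_nbhs_nbhs|exact: NU].
(* [Q] is small enough that [psi] maps it into [N] and that [phi \o psi] is the identity on it. *)
have [Q [[oQ Qp] QV]] : exists Q, open_nbhs (phi p) Q /\
    Q `<=` psi @^-1` N `&` phi @` U.
  have : nbhs (phi p) (psi @^-1` N `&` phi @` U).
    by apply: filterI => //; exact: open_nbhs_nbhs.
  by rewrite nbhsE => -[Q oQ QV]; exists Q.
apply: (@eq_flat _ _ _ Q (fun r => g (phi (psi r)))) => //.
  by move=> _ /QV[_ [r Ur <-]]; rewrite psiK.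
apply: (flat_comp (g := fun r => g (phi r)) (N := N)) oQ _ _ _ _ _ => //.
- by move=> q /QV[].
- by apply: smooth_onS psiV => q /QV[].
- exact: smooth_on_comp gM.
- by rewrite psiK//; exact: NU.
Qed.

(** * Jet equations as vanishing conditions, and their transport between related metrics *)

(** One of the [k.+1] derivatives is spent on h_v, leaving order [k]. As [partial] applies
    v-derivatives first, the index [l.+1] turns into [l] derivatives of h_v without any exchange of
    derivatives. *)
Lemma Ek_jet_of (R : realType) (k : nat) (O : set 'rV[R]_3)
    (s : 'rV[R]_3 -> 'rV[R]_3) (p : 'rV[R]_3) : open O -> O p ->
  smooth_on O (fun q => s q 0 ih) ->
  @Ek R k.+1 (jet_of k.+1 s p) <->
  0 < s p 0 ih /\ flat k ('D_e_v (fun q => s q 0 ih)) p.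
Proof.
move=> oO Op hO; have jE i j l : (i + j + l <= k)%N ->
    jcoord ih i j l.+1 (jet_of k.+1 s p) = partial i j l ('D_e_v (fun q => s q 0 ih)) p.
  by move=> ijl; rewrite jcoord_jet_of ?addnS// /partial iterSr.
have -> : @Ek R k.+1 (jet_of k.+1 s p) = (0 < s p 0 ih /\
    forall i j l, (i + j + l <= k)%N -> jcoord ih i j l.+1 (jet_of k.+1 s p) = 0).
  rewrite /Ek /= jcoord_jet_of//; congr (_ /\ _); apply/propext.
  by split=> H i j l; have := H i j l; rewrite addnS ltnS.
split=> -[h0 H]; split=> //.
  apply: (partial_eq0_flat oO) => // [|i j l ijl]; first exact: smooth_on_derive.
  by rewrite -jE// H.
by move=> i j l ijl; rewrite jE//; exact: flat_partial_eq0 ijl H.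
Qed.

(** The metric relation is required on a whole open set [N], and not only at the base point of a
    jet, so that it can be differentiated. *)
Definition kundt_transform (R : realType) (U N M : set 'rV[R]_3)
    (phi s s' : 'rV[R]_3 -> 'rV[R]_3) : Prop :=
  [/\ in_pseudogroup U phi, [/\ open N, N `<=` U & open M],
      forall q, N q -> M (phi q),
      forall a, smooth_on N (fun q => s q 0 a) /\ smooth_on M (fun q => s' q 0 a) &
      forall q, N q -> acts0 phi q (s q) (s' (phi q))].

Lemma prolongs_kundt_transform (R : realType) (k : nat) (U : set 'rV[R]_3)
    (phi : 'rV[R]_3 -> 'rV[R]_3) (J J' : jet R k) :
  in_pseudogroup U phi -> prolongs U phi J J' ->
  exists p N M s s', [/\ kundt_transform U N M phi s s', N p,
    J = jet_of k s p, J' = jet_of k s' (phi p) & 0 < s' (phi p) 0 ih].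
Proof.
move=> gphi [Up [s [s' [[A [oA Ap sA _]] [M [oM Mp sM M0]] act Js Js']]]].
have phiU : smooth_on U phi by case: gphi => -[].
have oU : open U by case: gphi => -[].
have phic : {for J.1, continuous phi}.
  exact/differentiable_continuous/(smooth_on_differentiable phiU).
(* These four conditions hold together near the base point, which turns the germ relation of
   [prolongs] into one on an open set. *)
have : nbhs J.1 [set q | [/\ U q, A q, M (phi q) & acts0 phi q (s q) (s' (phi q))]].
  near=> q; split; near: q => //.
  - exact: open_nbhs_nbhs.
  - exact: open_nbhs_nbhs.
  - by apply: phic; exact: open_nbhs_nbhs.
rewrite nbhsE => -[N [oN Np] NH].
exists J.1, N, M, s, s'; split=> //; last exact: M0.
split=> //.
- by split=> // q /NH[].
- by move=> q /NH[].
- move=> a; split; last exact: smooth_on_coord.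
  by apply: smooth_on_coord => //; apply: smooth_onS sA => q /NH[].
- by move=> q /NH[].
Unshelve. all: by end_near. Qed.

Lemma kundt_transform_Diter (R : realType) (U N M : set 'rV[R]_3)
    (phi s s' : 'rV[R]_3 -> 'rV[R]_3) (d : 'rV[R]_3 -> R) (a : 'I_3) (l : nat)
    (q : 'rV[R]_3) : kundt_transform U N M phi s s' -> v_const U d -> N q ->
  Diter l e_v (fun r => d r * s' (phi r) 0 a) q =
  d q * (dphi phi iu e_u q)^-1 ^+ l * Diter l e_v (fun r => s' r 0 a) (phi q).
Proof.
move=> [gphi [oN NU oM] NM ss act] /(v_constS NU) vd Nq; have [_ aM] := ss a.
have phiN : smooth_on N phi by case: gphi => -[_ _ /(smooth_onS NU)].
have aN := smooth_on_comp oN NM phiN aM.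
rewrite (Diter_v_constM l oN vd aN Nq).
by rewrite (Diter_comp_pseudogroup l gphi oN NU NM aM Nq) mulrA.
Qed.

Lemma kundt_transform_smooth (R : realType) (U N M : set 'rV[R]_3)
    (phi s s' : 'rV[R]_3 -> 'rV[R]_3) (d : 'rV[R]_3 -> R) (a : 'I_3) :
  kundt_transform U N M phi s s' -> v_const U d ->
  smooth_on N (fun r => d r * s' (phi r) 0 a).
Proof.
move=> [gphi [oN NU oM] NM ss act] /(v_constS NU)[dN _]; have [_ aM] := ss a.
have phiN : smooth_on N phi by case: gphi => -[_ _ /(smooth_onS NU)].
apply: (smooth_onM oN dN); exact: smooth_on_comp oN NM phiN aM.
Qed.

(** Differentiating h = Q^2 h' along v relates h_v and h'_v by the invertible factor Q^2 / P. Hence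
    h'_v composed with [phi] is a smooth multiple of h_v, and [flat_pseudogroup] removes [phi]. *)
Lemma kundt_transform_flat_h (R : realType) (U N M : set 'rV[R]_3)
    (phi s s' : 'rV[R]_3 -> 'rV[R]_3) (k : nat) (p : 'rV[R]_3) :
  kundt_transform U N M phi s s' -> N p ->
  flat k ('D_e_v (fun q => s q 0 ih)) p ->
  flat k ('D_e_v (fun q => s' q 0 ih)) (phi p).
Proof.
move=> tr Np fk; have [gphi [oN NU oM] NM ss act] := tr.
have [hN hM] := ss ih; have DhM := smooth_on_derive e_v hM.
set P := dphi phi iu e_u; set Q := dphi phi ix e_x.
have [vP vQ _ _ _] := pseudogroup_v_const gphi.
have oU : open U by case: gphi => -[].
have P0 q : N q -> P q != 0 by move=> /NU /(pseudogroup_jacobian gphi)[].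
have Q0 q : N q -> Q q != 0 by move=> /NU /(pseudogroup_jacobian gphi)[].
have E q : N q -> 'D_e_v (fun r => s r 0 ih) q =
    Q q * Q q * (P q)^-1 * 'D_e_v (fun r => s' r 0 ih) (phi q).
  move=> Nq; rewrite (eq_on_derive (g := fun r => Q r * Q r * s' (phi r) 0 ih) _ oN)//.
    exact: (kundt_transform_Diter ih 1 tr (v_constM oU vQ vQ) Nq).
  by move=> r Nr; have [-> _ _] := acts0E gphi (NU _ Nr) (act _ Nr); rewrite expr2.
apply: (flat_pseudogroup gphi oN NU Np oM NM DhM).
pose c q := P q * (Q q * Q q)^-1.
apply: (@eq_flat _ _ _ N (fun q => c q * 'D_e_v (fun r => s r 0 ih) q)) => //.
  by move=> q Nq; rewrite E// /c; field; rewrite P0// Q0.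
apply: (flatM oN) => //; first exact: smooth_on_derive.
have [PN _] := v_constS NU vP; have [QN _] := v_constS NU vQ.
apply: (smooth_onM oN PN); apply: (smooth_onV oN); first exact: smooth_onM.
by move=> q Nq; rewrite mulf_neq0// Q0.
Qed.

(** The inhomogeneous term P S is constant along v and disappears with the first v-derivative; this
    is why the order is [l.+1]. *)
Lemma kundt_transform_W (R : realType) (U N M : set 'rV[R]_3)
    (phi s s' : 'rV[R]_3 -> 'rV[R]_3) (l : nat) (q : 'rV[R]_3) :
  kundt_transform U N M phi s s' -> N q ->
  let d a w := dphi phi a w q in
  Diter l.+1 e_v (fun r => s r 0 iW) q =
  d iu e_u * d ix e_x * (d iu e_u)^-1 ^+ l.+1 *
    Diter l.+1 e_v (fun r => s' r 0 iW) (phi q) +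
  2 * d ix e_u * d ix e_x * (d iu e_u)^-1 ^+ l.+1 *
    Diter l.+1 e_v (fun r => s' r 0 ih) (phi q).
Proof.
move=> tr Nq d; have [gphi [oN NU oM] NM ss act] := tr.
have oU : open U by case: gphi => -[].
have [vP vQ vT vS _] := pseudogroup_v_const gphi.
have v2 : v_const U (fun=> 2).
  by split=> [|r _]; [exact: smooth_on_cst|exact: derive_cst].
have vPQ := v_constM oU vP vQ; have vTQ := v_constM oU (v_constM oU v2 vT) vQ.
have vPS := v_constS NU (v_constM oU vP vS).
pose D a w := dphi phi a w.
have E r : N r -> s r 0 iW = D iu e_u r * D iv e_x r +
    (D iu e_u r * D ix e_x r * s' (phi r) 0 iW +
     2 * D ix e_u r * D ix e_x r * s' (phi r) 0 ih).
  by move=> Nr; have [] := acts0E gphi (NU _ Nr) (act _ Nr).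
rewrite (eq_on_Diter l.+1 e_v oN E Nq).
have WN := kundt_transform_smooth iW tr vPQ.
have hN := kundt_transform_smooth ih tr vTQ.
rewrite (DiterD l.+1 e_v oN vPS.1 (smooth_onD oN WN hN) Nq).
rewrite (DiterD l.+1 e_v oN WN hN Nq).
rewrite (kundt_transform_Diter iW l.+1 tr vPQ Nq).
rewrite (kundt_transform_Diter ih l.+1 tr vTQ Nq).
by rewrite [in LHS]iterSr (Diter0 l e_v oN vPS.2 Nq) add0r.
Qed.

(** Here the inhomogeneous term P Z is affine along v, so two derivatives are needed to remove it
    and the order is [l.+2]. *)
Lemma kundt_transform_H (R : realType) (U N M : set 'rV[R]_3)
    (phi s s' : 'rV[R]_3 -> 'rV[R]_3) (l : nat) (q : 'rV[R]_3) :
  kundt_transform U N M phi s s' -> N q ->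
  let d a w := dphi phi a w q in
  Diter l.+2 e_v (fun r => s r 0 iH) q =
  d iu e_u ^+ 2 * (d iu e_u)^-1 ^+ l.+2 *
    Diter l.+2 e_v (fun r => s' r 0 iH) (phi q) +
  (d iu e_u * d ix e_u * (d iu e_u)^-1 ^+ l.+2 *
    Diter l.+2 e_v (fun r => s' r 0 iW) (phi q) +
  d ix e_u ^+ 2 * (d iu e_u)^-1 ^+ l.+2 *
    Diter l.+2 e_v (fun r => s' r 0 ih) (phi q)).
Proof.
move=> tr Nq d; have [gphi [oN NU oM] NM ss act] := tr.
have oU : open U by case: gphi => -[].
have [vP vQ vT vS vDZ] := pseudogroup_v_const gphi.
have vPP := v_constM oU vP vP; have vPT := v_constM oU vP vT.
have vTT := v_constM oU vT vT.
pose D a w := dphi phi a w.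
have E r : N r -> s r 0 iH = D iu e_u r * D iv e_u r +
    (D iu e_u r * D iu e_u r * s' (phi r) 0 iH +
    (D iu e_u r * D ix e_u r * s' (phi r) 0 iW +
     D ix e_u r * D ix e_u r * s' (phi r) 0 ih)).
  by move=> Nr; have [] := acts0E gphi (NU _ Nr) (act _ Nr); rewrite !expr2.
rewrite (eq_on_Diter l.+2 e_v oN E Nq).
have HN := kundt_transform_smooth iH tr vPP.
have WN := kundt_transform_smooth iW tr vPT.
have hN := kundt_transform_smooth ih tr vTT.
have ZN : smooth_on N (D iv e_u).
  apply: smooth_onS NU _; apply: smooth_on_derive.
  exact: pseudogroup_smooth_on gphi.
have PN := v_constS NU vP.
rewrite (DiterD l.+2 e_v oN (smooth_onM oN PN.1 ZN)
  (smooth_onD oN HN (smooth_onD oN WN hN)) Nq).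
rewrite (DiterD l.+2 e_v oN HN (smooth_onD oN WN hN) Nq).
rewrite (DiterD l.+2 e_v oN WN hN Nq).
rewrite (kundt_transform_Diter iH l.+2 tr vPP Nq).
rewrite (kundt_transform_Diter iW l.+2 tr vPT Nq).
rewrite (kundt_transform_Diter ih l.+2 tr vTT Nq).
(* P is pulled out first; the two innermost derivatives then fall on Z, and the second one
   annihilates D_v Z. *)
rewrite (Diter_v_constM l.+2 oN PN ZN Nq) 2![in LHS]iterSr.
by rewrite (Diter0 l e_v oN (v_constS NU vDZ).2 Nq) mulr0 add0r !expr2.
Qed.

(** Solving the law for the second derivatives gives W'_vv = (P / Q) W_vv - 2 (T / P) h'_vv with
    primed terms taken at [phi], and both terms on the right are flat. *)
Lemma kundt_transform_flat_W (R : realType) (U N M : set 'rV[R]_3)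
    (phi s s' : 'rV[R]_3 -> 'rV[R]_3) (k : nat) (p : 'rV[R]_3) :
  kundt_transform U N M phi s s' -> N p ->
  flat k (Diter 2 e_v (fun q => s' q 0 ih)) (phi p) ->
  flat k (Diter 2 e_v (fun q => s q 0 iW)) p ->
  flat k (Diter 2 e_v (fun q => s' q 0 iW)) (phi p).
Proof.
move=> tr Np fh fW; have [gphi [oN NU oM] NM ss act] := tr.
have [_ hM] := ss ih; have [WN WM] := ss iW.
have h2M := smooth_on_Diter 2 e_v hM; have W2M := smooth_on_Diter 2 e_v WM.
have W2N := smooth_on_Diter 2 e_v WN.
have phiN : smooth_on N phi by case: gphi => -[_ _ /(smooth_onS NU)].
pose D a w := dphi phi a w.
have P0 q : N q -> D iu e_u q != 0 by move=> /NU /(pseudogroup_jacobian gphi)[].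
have Q0 q : N q -> D ix e_x q != 0 by move=> /NU /(pseudogroup_jacobian gphi)[].
have [vP vQ vT _ _] := pseudogroup_v_const gphi.
have [PN _] := v_constS NU vP; have [QN _] := v_constS NU vQ.
have [TN _] := v_constS NU vT.
have cN : smooth_on N (fun q => D iu e_u q * (D ix e_x q)^-1).
  by apply: (smooth_onM oN) => //; exact: smooth_onV.
have dN : smooth_on N (fun q => -2 * (D ix e_u q * (D iu e_u q)^-1)).
  apply: (smooth_onM oN); first exact: smooth_on_cst.
  by apply: (smooth_onM oN) => //; exact: smooth_onV.
have h2N := smooth_on_comp oN NM phiN h2M.
apply: (flat_pseudogroup gphi oN NU Np oM NM W2M).
apply: (@eq_flat _ _ _ N (fun q =>
    (D iu e_u q * (D ix e_x q)^-1) * Diter 2 e_v (fun r => s r 0 iW) q +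
    (-2 * (D ix e_u q * (D iu e_u q)^-1)) *
      Diter 2 e_v (fun r => s' r 0 ih) (phi q))) => //.
  move=> q Nq; rewrite (kundt_transform_W 1 tr Nq) -/(D _ _ _).
  move: (P0 q Nq) (Q0 q Nq); rewrite /D.
  set P := 'D_e_u _ q; set Q := 'D_e_x _ q; set T := 'D_e_u _ q.
  set h := Diter _ _ _ _; set W := Diter _ _ _ _.
  clearbody P Q T h W => P00 Q00; field; exact/andP.
apply: (flatD oN Np (smooth_onM oN cN W2N) (smooth_onM oN dN h2N)).
  exact: flatM oN Np W2N cN fW.
apply: (flatM oN Np h2N dN).
exact: flat_comp oN Np NM phiN h2M fh.
Qed.

Lemma E3_Wvv0_jet_of (R : realType) (O : set 'rV[R]_3)
    (s : 'rV[R]_3 -> 'rV[R]_3) (p : 'rV[R]_3) : open O -> O p ->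
  smooth_on O (fun q => s q 0 iW) ->
  @E3_Wvv0 R (jet_of 3 s p) <->
  @Ek R 3 (jet_of 3 s p) /\ flat 1 (Diter 2 e_v (fun q => s q 0 iW)) p.
Proof.
move=> oO Op WO; rewrite /E3_Wvv0 /= !jcoord_jet_of//.
have W2O : smooth_on O (Diter 2 e_v (fun q => s q 0 iW)) by exact: smooth_on_Diter.
split=> -[E H]; split=> //.
  case: H => H0 Hu Hx Hv.
  (* Order at most 1 leaves four multi-indices, which match the four equations; all others
     contradict [ijl]. *)
  apply: (partial_eq0_flat oO Op W2O) => -[|[|i]] [|[|j]] [|[|l]] ijl;
    try discriminate ijl.
  - exact: H0.
  - exact: Hv.
  - exact: Hx.
  - exact: Hu.
split.
- exact: (@flat_partial_eq0 _ 1 0 0 0 _ _ isT H).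
- exact: (@flat_partial_eq0 _ 1 1 0 0 _ _ isT H).
- exact: (@flat_partial_eq0 _ 1 0 1 0 _ _ isT H).
- exact: (@flat_partial_eq0 _ 1 0 0 1 _ _ isT H).
Qed.

(** * Invariance of the equations and the two relative invariants *)

Lemma invariant_Ek (R : realType) (k : nat) : Defs.invariant (@Ek R k.+1).
Proof.
move=> U phi J J' gphi /(prolongs_kundt_transform gphi).
move=> [p [N [M [s [s' [tr Np -> -> h'0]]]]]].
have [_ [oN NU oM] NM ss _] := tr; have [hN hM] := ss ih.
move=> /(Ek_jet_of _ oN Np hN)[_ fh].
by apply/(Ek_jet_of _ oM (NM _ Np) hM); split=> //; exact: kundt_transform_flat_h tr Np fh.
Qed.

(** On the third-order equation h_v is flat to order 2, hence so is h'_v at the image. Thus h'_vv is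
    flat to order 1, exactly what the transport of W_vv to that order requires. *)
Lemma invariant_E3_Wvv0 (R : realType) : Defs.invariant (@E3_Wvv0 R).
Proof.
move=> U phi J J' gphi pJ; have /(_ gphi pJ) := @invariant_Ek R 2 U phi J J'.
move: pJ => /(prolongs_kundt_transform gphi).
move=> [p [N [M [s [s' [tr Np -> -> h'0]]]]]].
have [_ [oN NU oM] NM ss _] := tr; have [WN WM] := ss iW; have [hN hM] := ss ih.
move=> EE /(E3_Wvv0_jet_of oN Np WN)[E fW].
apply/(E3_Wvv0_jet_of oM (NM _ Np) WM); split; first exact: EE.
have [_ fh] := (Ek_jet_of _ oN Np hN).1 E.
have /flatS[_ fh'] := kundt_transform_flat_h tr Np fh.
by apply: kundt_transform_flat_W tr Np (fh' e_v) fW.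
Qed.

Lemma open_fst_preimage (U V : topologicalType) (A : set U) :
  open A -> open [set q : U * V | A q.1].
Proof. by move=> oA; apply: open_comp => // q _; exact: continuous_fst. Qed.

Theorem theorem20 (R : realType) :
  relative_invariant (@Ek R 2) (fun J => jcoord iW 0 0 2 J) /\
  relative_invariant (@E3_Wvv0 R) (fun J => jcoord iH 0 0 3 J).
Proof.
split; split; [exact: invariant_Ek| |exact: invariant_E3_Wvv0|] => U phi gphi.
- have oU : open U by case: gphi => -[].
  have [[PU _] [QU _] _ _ _] := pseudogroup_v_const gphi.
  have jac := pseudogroup_jacobian gphi.
  (* The weight P / Q depends on the base point alone, so it is smooth on the open set of all jets
     over [U]. *)
  exists (fun J => dphi phi iu e_u J.1 * (dphi phi ix e_x J.1)^-1).
  exists [set J | U J.1]; split.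
  + exact: open_fst_preimage.
  + by move=> J [].
  + apply: (smooth_on_fst (f := fun q => dphi phi iu e_u q * (dphi phi ix e_x q)^-1)).
    by apply: smooth_onM => //; apply: smooth_onV => // q /jac[].
  + by move=> J _ /jac[P0 Q0 _ _]; rewrite mulf_neq0 ?invr_eq0.
  move=> J J' EJ /(prolongs_kundt_transform gphi).
  move=> [p [N [M [s [s' [tr Np EJ1 -> h'0]]]]]].
  move: EJ; rewrite {}EJ1 !jcoord_jet_of//=.
  have [_ [oN NU oM] NM ss _] := tr; have [hN hM] := ss ih.
  move=> /(Ek_jet_of _ oN Np hN)[_ /(kundt_transform_flat_h tr Np) /flatS[_ fh]].
  (* On the second-order equation h'_v is flat to order 1 at the image, so the T term drops out of
     the law for W_vv. *)
  have h0 : Diter 2 e_v (fun r => s' r 0 ih) (phi p) = 0 by exact: flat_eq0 (fh e_v).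
  rewrite /partial /= in h0 *.
  have := kundt_transform_W 1 tr Np; rewrite /= h0 => ->.
  have [P0 Q0 _ _] := jac _ (NU _ Np).
  move: P0 Q0; set P := 'D_e_u _ p; set Q := 'D_e_x _ p; set T := 'D_e_u _ p.
  set W := 'D_e_v _ _; clearbody P Q T W => P0 Q0; field; exact/andP.
- have oU : open U by case: gphi => -[].
  have [[PU _] _ _ _ _] := pseudogroup_v_const gphi.
  have jac := pseudogroup_jacobian gphi.
  exists (fun J => dphi phi iu e_u J.1), [set J | U J.1]; split.
  + exact: open_fst_preimage.
  + by move=> J [].
  + exact: (smooth_on_fst (f := dphi phi iu e_u)).
  + by move=> J _ /jac[].
  (* The law for H expresses unprimed derivatives by primed ones, so the W and h terms must vanish
     at the image jet; invariance supplies this. *)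
  move=> J J' EJ pJ; have := @invariant_E3_Wvv0 R U phi J J' gphi pJ EJ.
  move: pJ EJ => /(prolongs_kundt_transform gphi).
  move=> [p [N [M [s [s' [tr Np -> -> h'0]]]]]] _.
  have [_ [oN NU oM] NM ss _] := tr; have [hN hM] := ss ih; have [WN WM] := ss iW.
  move=> /(E3_Wvv0_jet_of oM (NM _ Np) WM)[/(Ek_jet_of _ oM (NM _ Np) hM)[_ fh] fW].
  (* h'_vvv is a second derivative of h'_v, flat to order 2, while W'_vvv below is a first
     derivative of W'_vv, flat to order 1. *)
  have h0 : Diter 3 e_v (fun r => s' r 0 ih) (phi p) = 0.
    exact: (@flat_partial_eq0 _ 2 0 0 2 _ _ isT fh).
  have W0 : Diter 3 e_v (fun r => s' r 0 iW) (phi p) = 0.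
    exact: (@flat_partial_eq0 _ 1 0 0 1 _ _ isT fW).
  (* The algebra is isolated over plain real numbers: the coefficient of H'_vvv is P^2 P^-3 = P^-1,
     and inverting it gives the weight P. *)
  have cancel (P T H H' W' h' : R) : P != 0 -> W' = 0 -> h' = 0 ->
      H = P ^+ 2 * P^-1 ^+ 3 * H' +
        (P * T * P^-1 ^+ 3 * W' + T ^+ 2 * P^-1 ^+ 3 * h') ->
      H' = P * H.
    by move=> P0 -> -> ->; field.
  have jE (f : 'rV[R]_3 -> 'rV[R]_3) q : jcoord iH 0 0 3 (jet_of 3 f q) =
      Diter 3 e_v (fun r => f r 0 iH) q by exact: jcoord_jet_of.
  have [P0 _ _ _] := jac _ (NU _ Np).
  rewrite !jE; exact: cancel P0 W0 h0 (kundt_transform_H 1 tr Np).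
Qed.
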